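(* The spaces $(\mathfrak D,\diamond)$ and $(\mathfrak D,\sqcup\!\sqcup)$ are commutative $\mathbb F_q$-algebras (with unit the empty word).
   Context: Let $q$ be a prime power. Let $\Gamma=\{x_{n,\varepsilon}\}_{n\in\mathbb N,\varepsilon\in\mathbb F_q^*}$ be an alphabet with weights $w(x_{n,\varepsilon})=n$, $\langle\Gamma\rangle$ the set of words over $\Gamma$ (empty word $1$, juxtaposition = concatenation) and $\mathfrak D$ the $\mathbb F_q$-vector space with basis $\langle\Gamma\rangle$; write $x_n:=x_{n,1}$. For positive integers $r,s,j$ put $\Delta^j_{r,s}=(-1)^{r-1}\binom{j-1}{r-1}+(-1)^{s-1}\binom{j-1}{s-1}$ if $(q-1)\mid j$ and $0$ otherwise. The bilinear products $\diamond,\sqcup\!\sqcup$ on $\mathfrak D$ are defined recursively by $1\diamond\mathfrak a=\mathfrak a\diamond1=\mathfrak a$, $1\sqcup\!\sqcup\mathfrak a=\mathfrak a\sqcup\!\sqcup1=\mathfrak a$ and, for nonempty words $\mathfrak a=x_{a,\alpha}\mathfrak a_-$, $\mathfrak b=x_{b,\beta}\mathfrak b_-$: $\mathfrak a\diamond\mathfrak b=x_{a+b,\alpha\beta}(\mathfrak a_-\sqcup\!\sqcup\mathfrak b_-)+\sum_{i+j=a+b}\Delta^j_{a,b}x_{i,\alpha\beta}(x_j\sqcup\!\sqcup(\mathfrak a_-\sqcup\!\sqcup\mathfrak b_-))$ and $\mathfrak a\sqcup\!\sqcup\mathfrak b=x_{a,\alpha}(\mathfrak a_-\sqcup\!\sqcup\mathfrak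 b)+x_{b,\beta}(\mathfrak a\sqcup\!\sqcup\mathfrak b_-)+\mathfrak a\diamond\mathfrak b$ ($i,j$ positive integers). *)

(* Defs.v *)
(* with multinomials' monoid algebra {malg F[K]} used as the
   free F-module with basis K (finitely supported functions K -> F). *)
From HB Require Import structures.
From mathcomp Require Import all_boot all_algebra.
From mathcomp Require Import finmap.
From mathcomp.multinomials Require Import monalg.

Set Implicit Arguments.
Unset Strict Implicit.
Unset Printing Implicit Defensive.

Import GRing.Theory.
Local Open Scope ring_scope.

Section Words.

Variable F : finFieldType.

Definition qF : nat := #|F|.

(* A letter x_{n,eps} with n >= 1 and eps in F_q^*  is encoded as the pair
   (n.-1, eps) : nat * {unit F}; its weight is (n.-1).+1 = n. *)
Definition letter : Type := (nat * {unit F})%type.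
Definition weight (x : letter) : nat := x.1.+1.
Definition sgn (x : letter) : F := val x.2.

(* x_{n,eps} for n >= 1 *)
Definition mkletter (n : nat) (e : {unit F}) : letter := (n.-1, e).

Definition word : Type := seq letter.

Definition D : Type := {malg F[word]}.

Definition bw (w : word) : D := << w >>.

Definition one_D : D := bw [::].

Definition xw (n : nat) : word := [:: mkletter n 1%g].

Definition lext (f : word -> D) (p : D) : D :=
  \sum_(w <- msupp p) p@_w *: f w.

Definition lcons (x : letter) (p : D) : D := lext (fun w => bw (x :: w)) p.

Definition Delta (r s j : nat) : F :=
  if (qF.-1 %| j)%N then
    (-1) ^+ r.-1 * ('C(j.-1, r.-1))%:R + (-1) ^+ s.-1 * ('C(j.-1, s.-1))%:R
  else 0.

(* The mutually recursive products on words, with a fuel parameter k that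
   is large enough when k >= 2 (|a| + |b|) + 1 (see dia_w / sh_w below). *)
Fixpoint sh_f (k : nat) (a b : word) {struct k} : D :=
  match a, b with
  | [::], _ => bw b
  | _, [::] => bw a
  | x :: a', y :: b' =>
    match k with
    | 0 => 0
    | k'.+1 => lcons x (sh_f k' a' b) + lcons y (sh_f k' a b') + dia_f k' a b
    end
  end
with dia_f (k : nat) (a b : word) {struct k} : D :=
  match a, b with
  | [::], _ => bw b
  | _, [::] => bw a
  | x :: a', y :: b' =>
    match k with
    | 0 => 0
    | k'.+1 =>
      let e := (x.2 * y.2)%g in
      let ab := sh_f k' a' b' in
      lcons (mkletter (weight x + weight y) e) ab
      + \sum_(1 <= j < weight x + weight y)
          Delta (weight x) (weight y) j *:
            lcons (mkletter (weight x + weight y - j) e)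
                  (lext (fun w => sh_f k' (xw j) w) ab)
    end
  end.

Definition fuel (a b : word) : nat := (2 * (size a + size b)).+1.

Definition dia_w (a b : word) : D := dia_f (fuel a b) a b.
Definition sh_w (a b : word) : D := sh_f (fuel a b) a b.

Definition dia (p r : D) : D :=
  \sum_(u <- msupp p) \sum_(v <- msupp r) (p@_u * r@_v) *: dia_w u v.
Definition sh (p r : D) : D :=
  \sum_(u <- msupp p) \sum_(v <- msupp r) (p@_u * r@_v) *: sh_w u v.

End Words.

(* Main.v *)
Require Import Defs.
From HB Require Import structures.
From mathcomp Require Import all_boot all_algebra all_field.
From mathcomp Require Import finmap ring zify.
From mathcomp.multinomials Require Import monalg.
Import GRing.Theory.
Local Open Scope ring_scope.
Set Implicit Arguments.
Unset Strict Implicit.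
Unset Printing Implicit Defensive.

(* Bilinearity, unit and commutativity follow from the recursion. For
   associativity, [x U <> y V] depends on [U] and [V] only through [U sh V], so
   by induction on the total depth everything reduces to the case of three
   letters, that is, to identities between the coefficients [Delta] in [F].
   These come from a model: for [V := F u + F] and a further variable [X], put
   [S1 i := \sum_(l : F) (u + l)^-i] and [S2 i := \sum_(v in V) (X + v)^-i].
   Partial fractions and [\sum_(l != 0) l^-j = - ((q - 1) %| j)] give
     [S2 a * S2 b =
        S2 (a + b) + \sum_j Delta a b j * S2 (a + b - j) * (1 + S1 j)],
   and likewise for [S1] without the last factor. Expanding the triple product
   [S2 a * S2 b * S2 c] and comparing the poles, first in [X] and then in [u],
   yields the invariance of all coefficients under cyclic shifts of
   [(a, b, c)]. *)

(** * Linear extension from words *)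

Section LinearExtension.
Variable F : finFieldType.
Implicit Types (p q r : D F) (u v w : word F) (f g : word F -> D F).
Implicit Types (h : word F -> word F -> D F).

Lemma lextEw f p (A : {fset word F}) : (msupp p `<=` A)%fset ->
  lext f p = \sum_(w <- A) p@_w *: f w.
Proof.
move=> sA; rewrite /lext (big_fset_incl _ sA) // => w _ wN.
by rewrite mcoeff_outdom // scale0r.
Qed.

Lemma lext_is_linear f : linear (lext f).
Proof.
move=> c p q.
pose A := (msupp (c *: p + q) `|` (msupp p `|` msupp q))%fset.
have sub x : (x `<=` (msupp p `|` msupp q))%fset -> (x `<=` A)%fset.
  by move=> /fsubset_trans; apply; apply: fsubsetUr.
rewrite !(@lextEw f _ A) ?fsubsetUl ?sub ?fsubsetUl ?fsubsetUr //.
rewrite scaler_sumr -big_split; apply: eq_bigr => w _.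
by rewrite mcoeffD mcoeffZ scalerDl scalerA.
Qed.

HB.instance Definition _ f :=
  GRing.isLinear.Build F (D F) (D F) *:%R (lext f) (lext_is_linear f).

Lemma lext_bw f w : lext f (bw w) = f w.
Proof. by rewrite /lext /bw msuppU oner_eq0 big_seq_fset1 mcoeffUU scale1r. Qed.

Lemma lext_id p : lext (@bw F) p = p.
Proof.
rewrite [RHS]monalgE /lext; apply: eq_bigr => w _; apply/malgP => v.
by rewrite mcoeffZ !mcoeffU -mulr_natr mul1r mulr_natr.
Qed.

(** Depth filtration of [D]: it carries fuel bounds and inductions on word length over from words to
    their linear combinations. *)
Definition dle n p := forall w, w \in msupp p -> (size w <= n)%N.

Lemma dle_ind n (P : D F -> Prop) :
  P 0 -> (forall c p q, P p -> P q -> P (c *: p + q)) ->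
  (forall w, (size w <= n)%N -> P (bw w)) ->
  forall p, dle n p -> P p.
Proof.
move=> P0 PD Pw p np; rewrite -(lext_id p) /lext big_seq.
apply: (big_ind P) => // [x y Px Py|w /np/Pw Pwn].
  by rewrite -[x]scale1r; apply: PD.
by rewrite -[_ *: _]addr0; apply: PD.
Qed.

Lemma D_ind (P : D F -> Prop) :
  P 0 -> (forall c p q, P p -> P q -> P (c *: p + q)) ->
  (forall w, P (bw w)) -> forall p, P p.
Proof.
move=> P0 PD Pw p; pose n := (\max_(w <- msupp p) size w)%N.
by apply: (@dle_ind n) => // w wp; apply: leq_bigmax_seq.
Qed.

Lemma dle0 n : dle n 0.
Proof. by move=> w; rewrite msupp0 inE. Qed.

Lemma dleP n c p q : dle n p -> dle n q -> dle n (c *: p + q).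
Proof.
move=> np nq w /(fsubsetP (msuppD_le _ _)); rewrite inE => /orP[|/nq //].
by move/(fsubsetP (msuppZ_le _ _))/np.
Qed.

Lemma dleD n p q : dle n p -> dle n q -> dle n (p + q).
Proof. by move=> np nq; rewrite -[p]scale1r; apply: dleP. Qed.

Lemma dleZ n c p : dle n p -> dle n (c *: p).
Proof. by move=> np; rewrite -[_ *: _]addr0; apply: dleP => //; apply: dle0. Qed.

Lemma dle_sum n (I : eqType) (s : seq I) (P : pred I) (G : I -> D F) :
  (forall i, i \in s -> P i -> dle n (G i)) -> dle n (\sum_(i <- s | P i) G i).
Proof.
rewrite big_seq_cond => nG; apply: (big_ind (dle n)) => //.
- exact: dle0.
- by move=> x y; apply: dleD.
- by move=> i /andP[]; apply: nG.
Qed.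

Lemma dle_bw n w : (size w <= n)%N -> dle n (bw w).
Proof. by move=> nw v; rewrite /bw msuppU oner_eq0 inE => /eqP->. Qed.

Lemma dle_leq m n p : (m <= n)%N -> dle m p -> dle n p.
Proof. by move=> mn mp w /mp/leq_trans; apply. Qed.

Lemma dle_lext m n f p : dle m p ->
  (forall w, (size w <= m)%N -> dle n (f w)) -> dle n (lext f p).
Proof. by move=> mp nf; apply: dle_sum => w /mp/nf ? _; apply: dleZ. Qed.

Lemma eq_lext_dle n f g p : dle n p ->
  (forall w, (size w <= n)%N -> f w = g w) -> lext f p = lext g p.
Proof. by move=> np fg; apply: eq_big_seq => w /np/fg->. Qed.

HB.instance Definition _ (x : letter F) :=
  GRing.isLinear.Build F (D F) (D F) *:%R (lcons x)
    (lext_is_linear (fun w => bw (x :: w))).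

Lemma lcons_bw x w : lcons x (bw w) = bw (x :: w).
Proof. exact: lext_bw. Qed.

Lemma dle_lcons n x p : dle n p -> dle n.+1 (lcons x p).
Proof. by move=> np; apply: (dle_lext np) => w nw; apply: dle_bw. Qed.

(* [dia] and [sh] are convertible to [bil dia_w] and [bil sh_w]. *)
Definition bil h p r : D F :=
  \sum_(u <- msupp p) \sum_(v <- msupp r) (p@_u * r@_v) *: h u v.

Lemma bil_lextl h p r : bil h p r = lext (fun u => lext (h u) r) p.
Proof.
apply: eq_bigr => u _; rewrite scaler_sumr; apply: eq_bigr => v _.
by rewrite scalerA.
Qed.

Lemma bil_lextr h p r : bil h p r = lext (fun v => lext (h^~ v) p) r.
Proof.
rewrite /bil exchange_big; apply: eq_bigr => u _; rewrite scaler_sumr.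
by apply: eq_bigr => v _; rewrite scalerA mulrC.
Qed.

Lemma bilPl h c p q r : bil h (c *: p + q) r = c *: bil h p r + bil h q r.
Proof. by rewrite !bil_lextl linearP. Qed.

Lemma bilPr h c p q r : bil h r (c *: p + q) = c *: bil h r p + bil h r q.
Proof. by rewrite !bil_lextr linearP. Qed.

Lemma bil_bw h u v : bil h (bw u) (bw v) = h u v.
Proof. by rewrite bil_lextl !lext_bw. Qed.

Lemma bil_bwl h u r : bil h (bw u) r = lext (h u) r.
Proof. by rewrite bil_lextl lext_bw. Qed.

Lemma dle_bil m n k h p r : dle m p -> dle n r ->
  (forall u v, (size u <= m)%N -> (size v <= n)%N -> dle k (h u v)) ->
  dle k (bil h p r).
Proof.
move=> mp nr kh; rewrite bil_lextl; apply: dle_lext mp _ => u mu.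
by apply: dle_lext nr _ => v nv; apply: kh.
Qed.

End LinearExtension.

(** * The products on words: recursion and commutativity *)

Arguments sh_f : simpl never.
Arguments dia_f : simpl never.
Arguments sh_w : simpl never.
Arguments dia_w : simpl never.

Section WordProducts.
Variable F : finFieldType.
Implicit Types (p q r : D F) (a b c : word F) (x y z : letter F).

Definition lmul x y (n : nat) : letter F := mkletter n (x.2 * y.2)%g.

Lemma sh_f_nill k b : sh_f k [::] b = bw b. Proof. by case: k. Qed.
Lemma sh_f_nilr k a : sh_f k a [::] = bw a.
Proof. by case: k => [|k]; case: a. Qed.
Lemma dia_f_nill k b : dia_f k [::] b = bw b. Proof. by case: k. Qed.
Lemma dia_f_nilr k a : dia_f k a [::] = bw a.
Proof. by case: k => [|k]; case: a. Qed.

Lemma sh_fS k x a y b : sh_f k.+1 (x :: a) (y :: b) =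
  lcons x (sh_f k a (y :: b)) + lcons y (sh_f k (x :: a) b)
  + dia_f k (x :: a) (y :: b).
Proof. by []. Qed.

Lemma dia_fS k x a y b : dia_f k.+1 (x :: a) (y :: b) =
  lcons (lmul x y (weight x + weight y)) (sh_f k a b)
  + \sum_(1 <= j < weight x + weight y) Delta F (weight x) (weight y) j *:
      lcons (lmul x y (weight x + weight y - j))
        (lext (fun w => sh_f k (xw F j) w) (sh_f k a b)).
Proof. by []. Qed.

(** Stability in the fuel is proved together with the depth bound, since the diamond recursion calls
    [sh_f] on the words in the support of [sh_f k a b], whose lengths must be controlled. The
    threshold for [dia_f] is one lower because [sh_f] at fuel [k.+1] calls [dia_f] at fuel [k] on
    the same words. *)
Lemma products_fuelS k a b :
  ((2 * (size a + size b) <= k)%N ->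
    sh_f k.+1 a b = sh_f k a b /\ dle (size a + size b) (sh_f k a b)) /\
  ((2 * (size a + size b) <= k.+1)%N ->
    dia_f k.+1 a b = dia_f k a b /\ dle (size a + size b) (dia_f k a b)).
Proof.
have base_l j b' : sh_f j.+1 [::] b' = sh_f j [::] b' /\
      dle (size ([::] : word F) + size b') (sh_f j [::] b').
  by rewrite !sh_f_nill; split=> //; apply: dle_bw.
have base_r j a' : sh_f j.+1 a' [::] = sh_f j a' [::] /\
      dle (size a' + size ([::] : word F)) (sh_f j a' [::]).
  by rewrite !sh_f_nilr; split=> //; apply: dle_bw; rewrite addn0.
have dbase_l j b' : dia_f j.+1 [::] b' = dia_f j [::] b' /\
      dle (size ([::] : word F) + size b') (dia_f j [::] b').
  by rewrite !dia_f_nill; split=> //; apply: dle_bw.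
have dbase_r j a' : dia_f j.+1 a' [::] = dia_f j a' [::] /\
      dle (size a' + size ([::] : word F)) (dia_f j a' [::]).
  by rewrite !dia_f_nilr; split=> //; apply: dle_bw; rewrite addn0.
elim: k a b => [|k IH] a b; case: a => [|x a];
  first [by split=> _; [apply: base_l | apply: dbase_l] | case: b => [|y b]];
  first [by split=> _; [apply: base_r | apply: dbase_r] | idtac].
  by split; rewrite /= !addSn !addnS !mulnS.
move: {base_l base_r dbase_l dbase_r} IH => IH.
have IHs u v (h : (2 * (size u + size v) <= k)%N) := (IH u v).1 h.
have IHd u v (h : (2 * (size u + size v) <= k.+1)%N) := (IH u v).2 h.
split; rewrite [size (_ :: _)]/= [size (y :: _)]/= => hk.
- have [|e1 d1] := IHs a (y :: b); first by rewrite /=; lia.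
  have [|e2 d2] := IHs (x :: a) b; first by rewrite /=; lia.
  have [|e3 d3] := IHd (x :: a) (y :: b); first by rewrite /=; lia.
  rewrite sh_fS e1 e2 e3 sh_fS; split=> //.
  apply: dleD; last by [].
  apply: dleD; rewrite ?addSn; first exact: dle_lcons.
  by rewrite addnS; apply: dle_lcons.
have [|e1 d1] := IHs a b; first by lia.
have e2 j w : (size w <= size a + size b)%N ->
    sh_f k.+1 (xw F j) w = sh_f k (xw F j) w /\
    dle (size w).+1 (sh_f k (xw F j) w).
  by move=> hw; apply: IHs; rewrite /=; lia.
rewrite dia_fS e1 dia_fS; split.
  have e4 j : lext (fun w => sh_f k.+1 (xw F j) w) (sh_f k a b) =
      lext (fun w => sh_f k (xw F j) w) (sh_f k a b).
    by apply: (eq_lext_dle d1) => w hw; apply: (e2 j w hw).1.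
  by apply: (congr1 (fun t => _ + t)); apply: eq_bigr => j _; rewrite e4.
rewrite addSn addnS; apply: dleD.
  by apply: dle_lcons; apply: dle_leq d1.
apply: dle_sum => j _ _; apply: dleZ; apply: dle_lcons.
apply: dle_lext d1 _ => w hw; apply: dle_leq (e2 j w hw).2.
by rewrite ltnS.
Qed.

Lemma sh_fE k a b : (2 * (size a + size b) <= k)%N -> sh_f k a b = sh_w a b.
Proof.
have stable m : sh_f (2 * (size a + size b) + m) a b =
    sh_f (2 * (size a + size b)) a b.
  elim: m => [|m <-]; first by rewrite addn0.
  by rewrite addnS; apply: ((products_fuelS _ a b).1 _).1; rewrite leq_addr.
by move/subnKC=> <-; rewrite stable -(stable 1) addn1.
Qed.

Lemma dia_fE k a b : (2 * (size a + size b) <= k.+1)%N ->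
  dia_f k a b = dia_w a b.
Proof.
have stable m : dia_f ((2 * (size a + size b)).-1 + m) a b =
    dia_f (2 * (size a + size b)).-1 a b.
  elim: m => [|m <-]; first by rewrite addn0.
  by rewrite addnS; apply: ((products_fuelS _ a b).2 _).1; lia.
move=> hk; have -> : k = ((2 * (size a + size b)).-1 +
  (k - (2 * (size a + size b)).-1))%N by lia.
rewrite stable /dia_w /fuel.
set n := (2 * _)%N in stable *.
by have -> : n.+1 = (n.-1 + (n.+1 - n.-1))%N by lia; rewrite stable.
Qed.

Lemma dle_sh_w a b : dle (size a + size b) (sh_w a b).
Proof.
by apply: ((products_fuelS _ a b).1 _).2; rewrite /fuel.
Qed.
Arguments dle_sh_w : clear implicits.

Definition xD j : D F := bw (xw F j).

(* The diamond product of [x U] and [y V] depends on [U] and [V] only through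
   [p := sh U V]. *)
Definition dia_tail x y p : D F :=
  lcons (lmul x y (weight x + weight y)) p
  + \sum_(1 <= j < weight x + weight y) Delta F (weight x) (weight y) j *:
      lcons (lmul x y (weight x + weight y - j)) (sh (xD j) p).

Lemma sh_w_cons x a y b : sh_w (x :: a) (y :: b) =
  lcons x (sh_w a (y :: b)) + lcons y (sh_w (x :: a) b)
  + dia_w (x :: a) (y :: b).
Proof. by rewrite {1}/sh_w /fuel sh_fS !sh_fE ?dia_fE //=; lia. Qed.

Lemma dia_w_cons x a y b :
  dia_w (x :: a) (y :: b) = dia_tail x y (sh_w a b).
Proof.
rewrite {1}/dia_w /fuel dia_fS sh_fE /=; last by lia.
have e j : lext (fun w => sh_f (2 * ((size a).+1 + (size b).+1)) (xw F j) w)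
    (sh_w a b) = sh (xD j) (sh_w a b).
  rewrite [RHS]bil_bwl; apply: (eq_lext_dle (dle_sh_w a b)) => w hw.
  by rewrite sh_fE //=; lia.
apply: (congr1 (fun t => _ + t)); apply: eq_bigr => j _.
by rewrite e.
Qed.

Lemma sh_w_nill b : sh_w [::] b = bw b. Proof. exact: sh_f_nill. Qed.
Lemma sh_w_nilr a : sh_w a [::] = bw a. Proof. exact: sh_f_nilr. Qed.
Lemma dia_w_nill b : dia_w [::] b = bw b. Proof. exact: dia_f_nill. Qed.
Lemma dia_w_nilr a : dia_w a [::] = bw a. Proof. exact: dia_f_nilr. Qed.

Lemma shPl e p q r : sh (e *: p + q) r = e *: sh p r + sh q r.
Proof. exact: bilPl. Qed.
Lemma shPr e p q r : sh r (e *: p + q) = e *: sh r p + sh r q.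
Proof. exact: bilPr. Qed.
Lemma diaPl e p q r : dia (e *: p + q) r = e *: dia p r + dia q r.
Proof. exact: bilPl. Qed.
Lemma diaPr e p q r : dia r (e *: p + q) = e *: dia r p + dia r q.
Proof. exact: bilPr. Qed.

HB.instance Definition _ p :=
  GRing.isLinear.Build F (D F) (D F) *:%R (sh p) (fun (c : F) q r => shPr c q r p).
HB.instance Definition _ p :=
  GRing.isLinear.Build F (D F) (D F) *:%R (dia p) (fun (c : F) q r => diaPr c q r p).

Lemma sh_bw a b : sh (bw a) (bw b) = sh_w a b. Proof. exact: bil_bw. Qed.
Lemma dia_bw a b : dia (bw a) (bw b) = dia_w a b. Proof. exact: bil_bw. Qed.

Opaque lext lcons sh_f dia_f sh_w dia_w.

Lemma lmulC x y n : lmul x y n = lmul y x n.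
Proof.
rewrite /lmul (_ : x.2 * y.2 = y.2 * x.2)%g //.
by apply: val_inj; rewrite /= mulrC.
Qed.

Lemma weight_mkletter n (e : {unit F}) : (0 < n)%N -> weight (mkletter n e) = n.
Proof. exact: prednK. Qed.

Lemma weight_lmul x y n : (0 < n)%N -> weight (lmul x y n) = n.
Proof. exact: weight_mkletter. Qed.

Lemma lmul1 i j n : lmul (mkletter i 1%g) (mkletter j 1%g) n = mkletter n 1%g.
Proof. by rewrite /lmul mul1g. Qed.

Opaque lmul.

Lemma DeltaC m n j : Delta F m n j = Delta F n m j.
Proof. by rewrite /Delta addrC. Qed.

Lemma dia_tailC x y p : dia_tail x y p = dia_tail y x p.
Proof.
rewrite /dia_tail [in LHS](addnC (weight x)) lmulC.
by apply: congr1; apply: eq_bigr => j _; rewrite DeltaC lmulC.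
Qed.

(** Joint induction on total length. The diamond case comes first: it needs only the shuffle of the
    tails and the symmetry of [dia_tail]. The shuffle case then uses it on the same two words. *)
Lemma products_wC a b : sh_w a b = sh_w b a /\ dia_w a b = dia_w b a.
Proof.
have [n] := ubnP (size a + size b).
elim: n a b => [|n IH] a b hn; first by rewrite ltn0 in hn.
case: a hn => [|x a] hn.
  by rewrite sh_w_nill sh_w_nilr dia_w_nill dia_w_nilr.
case: b hn => [|y b] hn.
  by rewrite sh_w_nill sh_w_nilr dia_w_nill dia_w_nilr.
rewrite /= in hn.
have dC : dia_w (x :: a) (y :: b) = dia_w (y :: b) (x :: a).
  rewrite !dia_w_cons dia_tailC (IH a b _).1; first by [].
  by lia.
split; last exact: dC.
have eA : sh_w a (y :: b) = sh_w (y :: b) a by apply: (IH _ _ _).1 => /=; lia.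
have eB : sh_w (x :: a) b = sh_w b (x :: a) by apply: (IH _ _ _).1 => /=; lia.
rewrite sh_w_cons.
rewrite dC.
rewrite eA.
rewrite eB.
rewrite sh_w_cons.
by rewrite [X in X + _ = _]addrC.
Qed.

Lemma shC p q : sh p q = sh q p.
Proof.
rewrite [LHS]bil_lextl [RHS]bil_lextr; apply: eq_bigr => u _.
by congr (_ *: _); apply: eq_bigr => v _; rewrite (products_wC u v).1.
Qed.

Lemma diaC p q : dia p q = dia q p.
Proof.
rewrite [LHS]bil_lextl [RHS]bil_lextr; apply: eq_bigr => u _.
by congr (_ *: _); apply: eq_bigr => v _; rewrite (products_wC u v).2.
Qed.

Lemma sh1p p : sh (one_D F) p = p.
Proof.
by rewrite [LHS]bil_bwl -[RHS]lext_id; apply: eq_bigr => w _; rewrite sh_w_nill.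
Qed.

Lemma dia1p p : dia (one_D F) p = p.
Proof.
by rewrite [LHS]bil_bwl -[RHS]lext_id; apply: eq_bigr => w _; rewrite dia_w_nill.
Qed.

Lemma dle_sh m n p q : dle m p -> dle n q -> dle (m + n) (sh p q).
Proof.
move=> mp nq; apply: dle_bil mp nq _ => u v mu nv.
by apply: dle_leq (dle_sh_w u v); apply: leq_add.
Qed.

End WordProducts.

(** * Power sums over F and over F u + F *)

Section PartialFractions.
Variable K : fieldType.

(* [pf_bin j s] is ['C(j - 1, s - 1)] extended to [j = 0] or [s = 0] so that
   Pascal's rule [pf_binS] holds everywhere. *)
Definition pf_bin (j s : nat) : nat :=
  match j, s with 0, s => (s == 0)%N | j'.+1, 0 => 0 | j'.+1, s'.+1 => 'C(j', s') end.

Lemma pf_binS j s : pf_bin j.+1 s.+1 = (pf_bin j s.+1 + pf_bin j s)%N.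
Proof. by case: j => [|j]; case: s => [|s] //=; rewrite ?bin0. Qed.

Lemma pf_bin_small j s : (j < s)%N -> pf_bin j s = 0%N.
Proof. by case: j s => [|j] [|s] //= js; apply: bin_small. Qed.

Definition pfL (j s : nat) : K := (-1) ^+ (j + s) * (pf_bin j s)%:R.
Definition pfR (j r : nat) : K := (-1) ^+ r * (pf_bin j r)%:R.

(** Induction on both exponents from [1 / (A B) = (1 / A - 1 / B) / (B - A)]; the coefficients
    combine by Pascal's rule. If [r] or [s] is 0, only the term [j = 0] survives. *)
Lemma partial_fractions (A B : K) r s :
  A != 0 -> B != 0 -> A != B -> (0 < r + s)%N ->
  A ^- r * B ^- s = \sum_(0 <= j < r + s)
    (B - A) ^- j * (pfL j s * A ^- (r + s - j) + pfR j r * B ^- (r + s - j)).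
Proof.
move=> A0 B0 AB.
have D0 : B - A != 0 by rewrite subr_eq0 eq_sym.
have pf0 j : pf_bin j 0 = (j == 0)%N by case: j.
elim: r s => [|r IHr] s; last elim: s => [|s IHs] _.
- case: s => [//|s] _; rewrite add0n big_nat_recl //= big_nat big1 => [|j js].
    rewrite /pfL /pfR /= !expr0 !(invr1, mulr0, mulr1, mul1r, mul0r).
    by rewrite !(add0r, addr0, mul1r) ?subn0.
  by rewrite /pfL /pfR pf_bin_small // pf0 !(mulr0, mul0r, addr0).
- rewrite addn0 big_nat_recl //= big_nat big1 => [|j js].
    rewrite /pfL /pfR /= !expr0 !(invr1, mulr0, mulr1, mul1r, mul0r).
    by rewrite !(add0r, addr0, mul1r) ?subn0.
  by rewrite /pfL /pfR [pf_bin _ r.+1]pf_bin_small // pf0 !(mulr0, mul0r, addr0).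
have -> : A ^- r.+1 * B ^- s.+1 =
    (B - A)^-1 * (A ^- r.+1 * B ^- s - A ^- r * B ^- s.+1).
  rewrite !exprS; field; rewrite ?A0 ?B0 ?D0 ?expf_neq0 //.
rewrite IHs // IHr ?addnS // addSn -sumrB mulr_sumr [RHS]big_nat_recl //.
rewrite [X in _ = X + _](_ : _ = 0) ?add0r; last first.
  by rewrite /pfL /pfR /= !(mulr0, mul0r, addr0).
apply: eq_bigr => j _; rewrite subSS exprS invfM -mulrA -mulrBr.
congr (_ * (_ * _)); rewrite /pfL /pfR !pf_binS !natrD !addSn !addnS !exprS.
ring.
Qed.
End PartialFractions.

Section PowerSums.
Variable F : finFieldType.

Lemma qF_gt1 : (1 < qF F)%N. Proof. exact: finNzRing_gt1. Qed.

(** The sum of all elements of [F] is unchanged by the translation [x |-> x + 1], which adds [q]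
    times 1 to it. *)
Lemma natr_qF : (qF F)%:R = 0 :> F.
Proof.
apply: (addrI (\sum_(x : F) x)); rewrite addr0.
rewrite [RHS](reindex_inj (addIr 1)) /= big_split /= sumr_const.
by rewrite /qF cardE.
Qed.

Lemma expf_card_pred (x : F) : x != 0 -> x ^+ (qF F).-1 = 1.
Proof.
move=> x0; apply: (mulfI x0); rewrite -exprS prednK ?expf_card ?mulr1 //.
exact: ltnW qF_gt1.
Qed.

(** If [q - 1] divides [j], each of the [q - 1] terms is 1. Otherwise some nonzero [y] has
    [y ^+ j != 1]; the substitution [x |-> y x] multiplies the sum by [y ^- j], so the sum
    vanishes. *)
Lemma sum_exprV_units j :
  \sum_(x : F | x != 0) x ^- j = - ((qF F).-1 %| j)%:R :> F.
Proof.
have q1 := qF_gt1.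
case: (boolP (_ %| j)%N) => [/dvdnP[k ->]|ndiv].
  under eq_bigr => x x0 do rewrite mulnC exprM expf_card_pred // expr1n invr1.
  rewrite sumr_const cardC1 -/(qF F) -[in LHS]subn1 mulrnBr; last exact: ltnW.
  by rewrite natr_qF sub0r.
have [y y0 yj] : exists2 y : F, y != 0 & y ^+ j != 1.
  case: (pickP [pred y : F | (y != 0) && (y ^+ j != 1)]) => [y /andP[]|all1].
    by exists y.
  (* Otherwise [X ^ r - 1], with [r] the nonzero remainder of [j] modulo [q - 1], would have
     [q - 1 > r] roots. *)
  exfalso; move: ndiv; rewrite /dvdn -lt0n => r0.
  have /(ltn_pmod j) : (0 < (qF F).-1)%N by rewrite -ltnS prednK // ltnW.
  rewrite ltnNge => /negP[].
  have sz : size (enum (predC1 (0 : F))) = (qF F).-1 by rewrite -cardE cardC1.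
  rewrite -[X in (X <= _)%N]sz.
  apply: (max_unity_roots r0) (enum_uniq _); apply/allP => x.
  rewrite mem_enum => x0; apply/unity_rootP.
  rewrite inE in x0; have := all1 x; rewrite /= x0 /= => /negbFE/eqP.
  by rewrite {1}(divn_eq j (qF F).-1) exprD mulnC exprM expf_card_pred // expr1n mul1r.
set s := \sum_(x | _) _; suff /eqP : (1 - y ^- j) * s = 0.
  rewrite mulf_eq0 subr_eq0 eq_sym invr_eq1 (negPf yj) /= => /eqP->.
  by rewrite oppr0.
rewrite mulrBl mul1r mulr_sumr /s [X in X - _](reindex_inj (mulfI y0)) /=.
apply/eqP; rewrite subr_eq0; apply/eqP; apply: eq_big => x.
  by rewrite mulf_eq0 negb_or y0.
by rewrite exprMn invfM.
Qed.

Lemma signr_dvd_card j : ((qF F).-1 %| j)%N -> (-1) ^+ j = 1 :> F.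
Proof.
by case/dvdnP => k ->; rewrite mulnC exprM expf_card_pred ?expr1n // oppr_eq0 oner_eq0.
Qed.

End PowerSums.

(** * Product rule for power sums *)

Section ProductFormula.
Variables (F : finFieldType) (K : fieldType) (phi : {rmorphism F -> K}).
Variables (I : finType) (y : I -> K) (M : seq K).
Hypothesis y_neq0 : forall i, y i != 0.
Hypothesis y_inj : injective y.
Hypothesis M_neq0 : forall m, m \in M -> m != 0.
(* The differences of the [y i] form the nonzero part of an [F]-vector space,
   whose lines are represented by [M]. *)
Hypothesis y_diff : forall i (g : K -> K),
  \sum_(k | k != i) g (y k - y i) =
  \sum_(m <- M) \sum_(l : F | l != 0) g (phi l * m).

Definition power_sum (a : nat) : K := \sum_i y i ^- a.
Definition monic_sum (j : nat) : K := \sum_(m <- M) m ^- j.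

Lemma diff_power_sum i j :
  \sum_(k | k != i) (y k - y i) ^- j = - phi ((qF F).-1 %| j)%:R * monic_sum j.
Proof.
rewrite (y_diff i (fun t => t ^- j)) -rmorphN -sum_exprV_units rmorph_sum.
rewrite mulr_sumr; apply: eq_bigr => m _; rewrite mulr_suml.
by apply: eq_bigr => l _; rewrite exprMn invfM fmorphV rmorphXn.
Qed.

(** The diagonal pairs [i = k] give [power_sum (a + b)]. The others are expanded by partial
    fractions; after exchanging the sums, [diff_power_sum] evaluates the inner ones and produces the
    divisibility condition of [Delta]. *)
Lemma power_sumM a b : (0 < a)%N -> (0 < b)%N ->
  power_sum a * power_sum b = power_sum (a + b) +
  \sum_(1 <= j < a + b) phi (Delta F a b j) * (power_sum (a + b - j) * monic_sum j).
Proof.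
move=> a0 b0.
have pf i k : k != i -> y i ^- a * y k ^- b = \sum_(1 <= j < a + b)
    (y k - y i) ^- j * (pfL K j b * y i ^- (a + b - j) + pfR K j a * y k ^- (a + b - j)).
  move=> ki; rewrite partial_fractions ?y_neq0 ?addn_gt0 ?a0 //; last first.
    by apply: contraNneq ki => /y_inj->.
  (* The term [j = 0] drops out, as [pf_bin 0 s = 0] for [s > 0]. *)
  rewrite big_ltn ?addn_gt0 ?a0 // /pfL /pfR.
  by case: a b a0 b0 => [|a] [|b] //= _ _; rewrite !(mulr0, mul0r, addr0, add0r).
rewrite /power_sum mulr_suml.
under eq_bigr => i _ do
  rewrite mulr_sumr (bigD1 i) //= -invfM -exprD (eq_bigr _ (pf i)).
rewrite big_split /=; congr (_ + _).
under eq_bigr => i _ do rewrite exchange_big.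
rewrite exchange_big; apply: eq_big_nat => j /andP[j0 _].
under eq_bigr => i _ do under eq_bigr => k _ do rewrite mulrDr.
under eq_bigr => i _ do rewrite big_split /=.
rewrite big_split /= [X in _ + X](exchange_big_dep predT) //=.
rewrite mulr_suml mulr_sumr -big_split; apply: eq_bigr => i _ /=.
under [X in _ + X]eq_bigl => k do rewrite eq_sym.
(* Exchanging [i] and [k] has reversed the differences; the resulting sign [(-1) ^ j] is 1 whenever
   [q - 1] divides [j]. *)
under [X in _ + X]eq_bigr => k _ do
  rewrite -opprB exprNn invfM -exprVn invrN1 mulrC mulrA.
rewrite -mulr_suml -mulr_sumr !diff_power_sum /Delta.
case: ifP => dvd; last by rewrite !(rmorph0, oppr0, mulr0, mul0r, addr0).
have sg : (-1) ^+ j = 1 :> K.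
  by rewrite -[-1](rmorphN1 phi) -rmorphXn signr_dvd_card // rmorph1.
rewrite /pfL /pfR exprD sg rmorphD !rmorphM !rmorphXn !rmorph_nat rmorphN1.
case: a b a0 b0 j j0 {pf dvd} sg => [//|a] [//|b] _ _ [//|j] _ sg /=.
rewrite [(-1) ^+ b.+1]exprS [(-1) ^+ a.+1]exprS.
ring.
Qed.

End ProductFormula.

(** * Linear independence of power sums with distinct poles *)

Section PoleIndependence.
Variables (K0 : fieldType) (I : finType) (iota : I -> K0) (i0 : I).
Hypothesis iota_inj : injective iota.
Hypothesis iota0 : iota i0 = 0.

Definition const_frac : {rmorphism K0 -> {fraction {poly K0}}} :=
  [the {rmorphism _ -> _} of @tofrac {poly K0} \o polyC].

Definition pole_poly (i : I) : {poly K0} := 'X + (iota i)%:P.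
Definition pole (i : I) : {fraction {poly K0}} := tofrac (pole_poly i).

Lemma pole_poly_inj : injective pole_poly.
Proof. by move=> i j /addrI/polyC_inj/iota_inj. Qed.

Lemma pole_inj : injective pole.
Proof. by move=> i j /eqP; rewrite tofrac_eq => /eqP/pole_poly_inj. Qed.

Lemma pole_neq0 i : pole i != 0.
Proof.
by rewrite tofrac_eq0 -size_poly_eq0 /pole_poly size_XaddC.
Qed.

Lemma pole_diff i k : pole k - pole i = const_frac (iota k - iota i).
Proof.
rewrite /pole -tofracB /pole_poly opprD addrACA subrr add0r.
by rewrite /= polyCB.
Qed.

(* Multiplying by the [n]-th power of the product of all [X + iota i] and
   setting [X = 0] isolates the coefficient of the pole of order [n] at [0]. *)
Lemma pole_independent n (c0 : K0) (c : nat -> K0) :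
  const_frac c0 + \sum_(1 <= k < n) const_frac (c k) * power_sum pole k = 0 ->
  forall k, (1 <= k < n)%N -> c k = 0.
Proof.
elim: n => [|n IH]; first by move=> _ k; rewrite ltn0 andbF.
case: n IH => [|n] IH; first by move=> _ [].
(* [m] is the highest pole order in the sum; its coefficient is shown to vanish, and the lower ones
   follow by induction. *)
set m := n.+1 in IH *; move=> sum0.
pose P i := \prod_(k | k != i) pole_poly k.
pose T : {poly K0} := (\prod_i pole_poly i) ^+ m.
(* [R k] is the numerator of [power_sum pole k] over the common denominator [T]. *)
pose R k := \sum_i pole_poly i ^+ (m - k) * P i ^+ m.
have RE k : (k <= m)%N -> tofrac T * power_sum pole k = tofrac (R k).
  move=> km; rewrite /power_sum mulr_sumr rmorph_sum; apply: eq_bigr => i _.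
  rewrite /T (bigD1 i) //= -/(P i) exprMn -[in LHS](subnK km) exprD !rmorphM.
  rewrite !rmorphXn /= -/(pole i) mulrAC.
  by rewrite subnK ?mulfK ?expf_neq0 ?pole_neq0.
have eq0 : T * c0%:P + \sum_(1 <= k < m.+1) (c k)%:P * R k = 0.
  apply/eqP; rewrite -tofrac_eq0 rmorphD rmorphM /= rmorph_sum /=.
  apply/eqP/(etrans _ (etrans (congr1 ( *%R (tofrac T)) sum0) (mulr0 _))).
  rewrite mulrDr mulr_sumr.
  apply: congr1; rewrite [LHS]big_nat [RHS]big_nat; apply: eq_bigr => k /andP[_ km].
  by rewrite rmorphM /= -RE // mulrCA.
have P0 i : (P i).[0] = \prod_(k | k != i) iota k.
  by rewrite horner_prod; apply: eq_bigr => k _; rewrite !hornerE.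
have PN i : i != i0 -> (P i).[0] = 0.
  by rewrite eq_sym => ii; rewrite P0 (bigD1 i0) //= iota0 mul0r.
have T0 : T.[0] = 0.
  rewrite /T horner_exp horner_prod (bigD1 i0) //= /pole_poly !hornerE iota0.
  by rewrite mul0r expr0n.
have R0 k : (k < m)%N -> (R k).[0] = 0.
  move=> km; rewrite /R horner_sum big1 // => i _; rewrite hornerM !horner_exp.
  have [->|ii] := eqVneq i i0; last by rewrite PN // expr0n mulr0.
  by rewrite /pole_poly !hornerE iota0 expr0n subn_eq0 leqNgt km mul0r.
(* Only the summand [i0] survives at 0; it is a power of the product of the other [iota k], nonzero
   by injectivity. *)
have Rm : (R m).[0] != 0.
  rewrite /R (bigD1 i0) //= hornerD horner_sum [X in _ + X]big1 ?addr0.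
    rewrite subnn mul1r horner_exp P0 expf_neq0 //.
    apply/prodf_neq0 => k ki; apply: contra_neq ki => k0.
    by apply: iota_inj; rewrite k0.
  by move=> i ii; rewrite hornerM !horner_exp PN // expr0n mulr0.
have cm : c m = 0.
  move/(congr1 (fun p => p.[0])): eq0.
  rewrite hornerD hornerM T0 mul0r add0r horner_sum big_nat_recr //=.
  rewrite big_nat big1 ?add0r => [|k /andP[_ km]]; last first.
    by rewrite hornerM R0 ?mulr0.
  by rewrite !hornerE => /eqP; rewrite mulf_eq0 (negPf Rm) orbF => /eqP.
move=> k /andP[k1]; rewrite ltnS leq_eqVlt => /orP[/eqP->//|km].
apply: IH; last by rewrite k1.
by rewrite big_nat_recr //= cm !rmorph0 mul0r addr0 in sum0.
Qed.

End PoleIndependence.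

(** * Cyclic symmetry of the structure constants *)

Section TripleExpansion.
Variables (R : comNzRingType) (d : nat -> nat -> nat -> R) (E : lmodType R).

Lemma sum_triangle N (G : nat -> nat -> E) :
  \sum_(1 <= j < N) \sum_(1 <= k < N - j) G j k =
  \sum_(1 <= m < N) \sum_(1 <= j < m) G j (m - j)%N.
Proof.
have shift j : \sum_(1 <= k < N - j) G j k =
    \sum_(1 <= m < N) (if (j < m)%N then G j (m - j)%N else 0).
  rewrite -big_mkcond -(big_nat_widenl _ _ _ predT _ (ltn0Sn j)) /=.
  by rewrite -[j.+1]add1n big_addn; apply: eq_bigr => k _; rewrite addnK.
rewrite (eq_bigr _ (fun j _ => shift j)) exchange_big_nat /=.
apply: eq_big_nat => m /andP[_ mN].
rewrite [RHS](big_nat_widen _ _ _ _ _ (ltnW mN)).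
by rewrite [RHS]big_mkcond.
Qed.

(** Coefficients arising when the product rule is applied to [a], [b] and then to the result and
    [c]: [triple_lin] belongs to the terms where one of the two steps contributes an auxiliary
    index, [triple_quad] to those where both do. *)
Definition triple_lin a b c m : R :=
  d (a + b) c m + (if (m < a + b)%N then d a b m else 0).
Definition triple_quad a b c j k : R :=
  if (j < a + b)%N then d a b j * d (a + b - j) c k else 0.

(** The double sum is regrouped by [m = j + k]. The module [E] is arbitrary so that this bookkeeping
    serves both for power sums, in a field over itself, and for words. *)
Lemma triple_expand a b c (f0 : E) (f1 : nat -> E) (f2 : nat -> nat -> E) :
  (0 < a)%N ->
  f0 + \sum_(1 <= k < a + b + c) d (a + b) c k *: f1 k
  + \sum_(1 <= j < a + b) d a b j *:
      (f1 j + \sum_(1 <= k < a + b - j + c) d (a + b - j) c k *: f2 j k) =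
  f0 + \sum_(1 <= m < a + b + c) (triple_lin a b c m *: f1 m +
      \sum_(1 <= j < m) triple_quad a b c j (m - j) *: f2 j (m - j)%N).
Proof.
move=> a0; rewrite -addrA; congr (_ + _).
have widen (G : nat -> E) : \sum_(1 <= j < a + b) G j =
    \sum_(1 <= j < a + b + c) (if (j < a + b)%N then G j else 0).
  by rewrite (big_nat_widen _ _ _ _ _ (leq_addr c _)) big_mkcond.
rewrite [RHS]big_split /=.
rewrite -(sum_triangle _ (fun j k => triple_quad a b c j k *: f2 j k)).
rewrite widen -!big_split /=.
apply: eq_big_nat => j /andP[j0 jN]; rewrite /triple_lin /triple_quad.
rewrite scalerDl -addrA; congr (_ + _).
case: ifP => jab; last by rewrite scale0r add0r big1 // => k _; rewrite scale0r.
rewrite scalerDr scaler_sumr; congr (_ + _).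
rewrite addnBAC ?(ltnW jab) //; apply: eq_bigr => k _.
by rewrite scalerA.
Qed.

(** The inner bracket is a product of two auxiliary factors. With [g s t := S1 s] and
    [g0 := 1 + S1 m] it is [(1 + S1 (m - j)) * (1 + S1 j)]; with [g s t] the word [x_s x_t] and
    [g0 := x_m] it is the shuffle of [x_(m - j)] and [x_j]. *)
Lemma tail_expand m (al : R) (w : nat -> R) (g0 : E) (g : nat -> nat -> E) :
  al *: g0 + \sum_(1 <= j < m) w j *:
    (g (m - j)%N j + g j (m - j)%N
     + (g0 + \sum_(1 <= l < m) d (m - j) j l *: g (m - l)%N l)) =
  (al + \sum_(1 <= j < m) w j) *: g0 +
  \sum_(1 <= s < m) (w s + w (m - s)%N + \sum_(1 <= j < m) w j * d (m - j) j (m - s))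
    *: g s (m - s)%N.
Proof.
have flip (G : nat -> nat -> E) : \sum_(1 <= j < m) G j (m - j)%N =
    \sum_(1 <= s < m) G (m - s)%N s.
  rewrite big_nat_rev /= add1n; apply: eq_big_nat => j /andP[j0 jm].
  by rewrite subSS subKn // ltnW.
under [X in _ = _ + X]eq_bigr => s _ do rewrite 2!scalerDl scaler_suml.
rewrite [in RHS]scalerDl scaler_suml -!addrA; congr (_ + _).
rewrite !big_split /= exchange_big_nat /=.
under eq_bigr => j _ do rewrite !scalerDr scaler_sumr.
rewrite !big_split /=.
have -> : \sum_(1 <= j < m) w j *: g (m - j)%N j =
    \sum_(1 <= s < m) w (m - s)%N *: g s (m - s)%N.
  rewrite (flip (fun s j => w (m - s)%N *: g s j)).
  by apply: eq_big_nat => j /andP[j0 jm]; rewrite subKn // ltnW.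
have -> : \sum_(1 <= j < m) \sum_(1 <= l < m) w j *: (d (m - j) j l *: g (m - l)%N l) =
   \sum_(1 <= j < m) \sum_(1 <= i < m) (w j * d (m - j)%N j (m - i)%N) *: g i (m - i)%N.
  apply: eq_bigr => j _.
  rewrite (flip (fun i l => (w j * d (m - j)%N j (m - i)%N) *: g i l)).
  apply: eq_big_nat => l /andP[l0 lm]; rewrite subKn ?scalerA //; exact: ltnW.
by rewrite addrCA [X in _ + (X + _) = _]addrC.
Qed.

(** These are the coefficients of [g0] and of [g s (m - s)] in [tail_expand], for the weights given
    by [triple_quad]. *)
Definition tail_head a b c m : R :=
  triple_lin a b c m + \sum_(1 <= j < m) triple_quad a b c j (m - j).
Definition tail_coef a b c m s : R :=
  triple_quad a b c s (m - s) + triple_quad a b c (m - s) (m - (m - s))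
  + \sum_(1 <= j < m) triple_quad a b c j (m - j) * d (m - j) j (m - s).

End TripleExpansion.

Section CyclicSymmetry.
Variables (F : comNzRingType) (K1 K2 : fieldType).
Variables (phi : {rmorphism F -> K1}) (cst : {rmorphism K1 -> K2}).
Variables (dl : nat -> nat -> nat -> F) (S1 : nat -> K1) (S2 : nat -> K2).

Hypothesis S1M : forall a b, (0 < a)%N -> (0 < b)%N -> S1 a * S1 b =
  S1 (a + b) + \sum_(1 <= j < a + b) phi (dl a b j) * S1 (a + b - j).
Hypothesis S2M : forall a b, (0 < a)%N -> (0 < b)%N -> S2 a * S2 b =
  S2 (a + b) + \sum_(1 <= j < a + b)
    cst (phi (dl a b j)) * (S2 (a + b - j) * cst (1 + S1 j)).
Hypothesis S1_independent : forall n (c0 : F) (c : nat -> F),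
  phi c0 + \sum_(1 <= k < n) phi (c k) * S1 k = 0 ->
  forall k, (1 <= k < n)%N -> c k = 0.
Hypothesis S2_independent : forall n (c : nat -> K1),
  \sum_(1 <= k < n) cst (c k) * S2 k = 0 ->
  forall k, (1 <= k < n)%N -> c k = 0.

Let p1 j : K1 := 1 + S1 j.

(** The coefficient of [S2 (a + b + c - m)] in [S2 a * S2 b * S2 c]. *)
Let tail1 a b c m : K1 :=
  phi (triple_lin dl a b c m) * p1 m +
  \sum_(1 <= j < m) phi (triple_quad dl a b c j (m - j)) *
    (p1 (m - j) * p1 j).

Let d1 a b j : K1 := phi (dl a b j).
Let d2 a b j : K2 := cst (phi (dl a b j)).

Let triple_lin2 a b c m :
  triple_lin d2 a b c m = cst (phi (triple_lin dl a b c m)).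
Proof. by rewrite /triple_lin !rmorphD; case: ifP => _ //; rewrite !rmorph0. Qed.

Let triple_quad1 a b c j k :
  triple_quad d1 a b c j k = phi (triple_quad dl a b c j k).
Proof. by rewrite /triple_quad; case: ifP; rewrite ?rmorphM ?rmorph0. Qed.

Let triple_quad2 a b c j k :
  triple_quad d2 a b c j k = cst (phi (triple_quad dl a b c j k)).
Proof. by rewrite /triple_quad; case: ifP; rewrite ?rmorphM ?rmorph0. Qed.

Let S2_triple a b c : (0 < a)%N -> (0 < b)%N -> (0 < c)%N ->
  S2 a * S2 b * S2 c = S2 (a + b + c) +
  \sum_(1 <= m < a + b + c) cst (tail1 a b c m) * S2 (a + b + c - m).
Proof.
move=> a0 b0 c0; have ab0 : (0 < a + b)%N by rewrite addn_gt0 a0.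
have -> : \sum_(1 <= m < a + b + c) cst (tail1 a b c m) * S2 (a + b + c - m) =
  \sum_(1 <= m < a + b + c) (triple_lin d2 a b c m * (S2 (a + b + c - m) * cst (p1 m)) +
   \sum_(1 <= j < m) triple_quad d2 a b c j (m - j) *
     (S2 (a + b + c - (j + (m - j))) * cst (p1 (m - j) * p1 j))).
  apply: eq_bigr => m _; rewrite /tail1 triple_lin2 rmorphD.
  rewrite rmorphM mulrDl rmorph_sum mulr_suml; congr (_ + _).
    by rewrite mulrAC -mulrA.
  apply: eq_big_nat => j /andP[_ jm].
  rewrite triple_quad2 rmorphM subnKC; last exact: ltnW.
  by rewrite mulrAC -mulrA.
have <- := @triple_expand K2 d2 K2^o a b c (S2 (a + b + c))
  (fun k => S2 (a + b + c - k) * cst (p1 k))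
  (fun j k => S2 (a + b + c - (j + k)) * cst (p1 k * p1 j)) a0.
rewrite S2M // mulrDl S2M // mulr_suml; congr (_ + _).
apply: eq_big_nat => j /andP[j0 jab].
rewrite -mulrA; congr (_ * _).
have jab0 : (0 < a + b - j)%N by rewrite subn_gt0.
rewrite mulrAC S2M // mulrDl mulr_suml addnBAC; last exact: ltnW.
congr (_ + _); apply: eq_bigr => k _.
by rewrite -!mulrA -rmorphM subnDA.
Qed.

(** The triple product in [K2] is commutative. Reversing the summation makes the pole order the
    index, and [S2_independent] then compares coefficients. *)
Let tail1_cyclic a b c m : (0 < a)%N -> (0 < b)%N -> (0 < c)%N ->
  (1 <= m < a + b + c)%N -> tail1 a b c m = tail1 b c a m.
Proof.
move=> a0 b0 c0 /andP[m0 mN].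
have rev (G : nat -> K2) N : \sum_(1 <= m < N) G m = \sum_(1 <= k < N) G (N - k)%N.
  by rewrite big_nat_rev add1n; under eq_bigr => k _ do rewrite subSS.
have bca : (b + c + a = a + b + c)%N by rewrite addnC addnA.
have eqS : S2 a * S2 b * S2 c = S2 b * S2 c * S2 a by rewrite [RHS]mulrC mulrA.
move: eqS; rewrite !S2_triple // bca => /addrI/eqP.
rewrite -subr_eq0 -sumrB rev => /eqP sum0.
pose e k := tail1 a b c (a + b + c - k) - tail1 b c a (a + b + c - k).
apply/eqP; rewrite -subr_eq0; apply/eqP.
suff : e (a + b + c - m)%N = 0 by rewrite /e subKn // ltnW.
apply: (@S2_independent (a + b + c)); last first.
  by rewrite subn_gt0 mN ltn_subrL m0 (ltn_trans m0).
rewrite -[RHS]sum0; apply: eq_big_nat => k /andP[_ kN].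
by rewrite subKn ?(ltnW kN) // /e rmorphB mulrBl.
Qed.

Let tail1E a b c m : tail1 a b c m = phi (tail_head dl a b c m) * p1 m +
  \sum_(1 <= s < m) phi (tail_coef dl a b c m s) * S1 s.
Proof.
have := @tail_expand K1 d1 K1^o m (phi (triple_lin dl a b c m))
  (fun j => triple_quad d1 a b c j (m - j)) (p1 m) (fun s _ => S1 s).
have -> : phi (tail_head dl a b c m) = phi (triple_lin dl a b c m) +
    \sum_(1 <= j < m) triple_quad d1 a b c j (m - j).
  rewrite /tail_head rmorphD rmorph_sum; congr (_ + _).
  by apply: eq_bigr => j _; rewrite triple_quad1.
have -> : \sum_(1 <= s < m) phi (tail_coef dl a b c m s) * S1 s =
    \sum_(1 <= s < m) (triple_quad d1 a b c s (m - s) +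
      triple_quad d1 a b c (m - s) (m - (m - s)) + \sum_(1 <= j < m)
         triple_quad d1 a b c j (m - j) * d1 (m - j) j (m - s)) * S1 s.
  apply: eq_bigr => s _; congr (_ * _); rewrite /tail_coef !rmorphD rmorph_sum.
  rewrite !triple_quad1; congr (_ + _); apply: eq_bigr => j _.
  by rewrite rmorphM triple_quad1.
move<-; rewrite /tail1; congr (_ + _); apply: eq_big_nat => j /andP[j0 jm].
rewrite triple_quad1; congr (_ * _).
have -> : p1 (m - j) * p1 j = S1 (m - j) + S1 j + (1 + S1 (m - j) * S1 j).
  by rewrite /p1; ring.
by rewrite S1M ?subn_gt0 // subnK ?addrA // ltnW.
Qed.

Lemma tail_coefs_cyclic a b c m : (0 < a)%N -> (0 < b)%N -> (0 < c)%N ->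
  (1 <= m < a + b + c)%N ->
  tail_head dl a b c m = tail_head dl b c a m /\ (forall s, (1 <= s < m)%N ->
    tail_coef dl a b c m s = tail_coef dl b c a m s).
Proof.
move=> a0 b0 c0 mN; have m0 := (andP mN).1.
pose h := tail_head dl a b c m - tail_head dl b c a m.
(* As [p1 m = 1 + S1 m], the difference [h] of the heads occurs both as the constant term and as the
   coefficient of [S1 m]. *)
pose e k := if (k < m)%N then tail_coef dl a b c m k - tail_coef dl b c a m k else h.
have e0 : forall k, (1 <= k < m.+1)%N -> e k = 0.
  apply: (@S1_independent _ h).
  have em : e m = h by rewrite /e ltnn.
  have eS : \sum_(1 <= k < m) phi (e k) * S1 k = \sum_(1 <= k < m)
      (phi (tail_coef dl a b c m k) * S1 k - phi (tail_coef dl b c a m k) * S1 k).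
    by apply: eq_big_nat => k /andP[_ km]; rewrite /e km rmorphB mulrBl.
  rewrite big_nat_recr //= em eS sumrB /h rmorphB.
  have /eqP := tail1_cyclic a0 b0 c0 mN.
  by rewrite -subr_eq0 !tail1E => /eqP; apply: etrans; rewrite /p1; ring.
split=> [|s /andP[s0 sm]]; apply/eqP; rewrite -subr_eq0; apply/eqP.
  by have := e0 m; rewrite /e ltnn m0 ltnSn; apply.
by have := e0 s; rewrite /e sm s0 ltnS (ltnW sm); apply.
Qed.

End CyclicSymmetry.

(** * The model in [F(u)] and [F(u)(X)] *)

Section DeltaIdentity.
Variable F : finFieldType.

Let K1 := {fraction {poly F}}.
Let phi1 : {rmorphism F -> K1} := const_frac F.
Let y1 : F -> K1 := pole id.
Let S1 := power_sum y1.

Let y1_neq0 i : y1 i != 0. Proof. exact: pole_neq0. Qed.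
Let y1_inj : injective y1. Proof. exact: pole_inj. Qed.

Let y1_diff i (g : K1 -> K1) : \sum_(k | k != i) g (y1 k - y1 i) =
  \sum_(m <- [:: 1]) \sum_(l : F | l != 0) g (phi1 l * m).
Proof.
rewrite big_seq1 (reindex_inj (addIr i)) /=; apply: eq_big => [l|l _].
  by rewrite -subr_eq0 addrK.
by rewrite pole_diff addrK mulr1.
Qed.

Let S1M a b : (0 < a)%N -> (0 < b)%N -> S1 a * S1 b = S1 (a + b) +
  \sum_(1 <= j < a + b) phi1 (Delta F a b j) * S1 (a + b - j).
Proof.
move=> a0 b0; rewrite (power_sumM y1_neq0 y1_inj y1_diff) //.
congr (_ + _); apply: eq_bigr => j _.
by rewrite /monic_sum big_seq1 expr1n invr1 mulr1.
Qed.

Let u : K1 := tofrac 'X.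
Let iota2 (t : F * F) : K1 := phi1 t.1 * u + phi1 t.2.
Let K2 := {fraction {poly K1}}.
Let phi2 : {rmorphism F -> K2} :=
  [the {rmorphism _ -> _} of const_frac K1 \o phi1].
Let y2 : F * F -> K2 := pole iota2.
Let S2 := power_sum y2.
(** One representative of each [F]-line in [F u + F]: 1 and the [u + l]. Hence the factor [1 + S1 j]
    in the product rule for [S2]. *)
Let M2 : seq K1 := 1 :: [seq y1 l | l <- index_enum F].

Let iota2_inj : injective iota2.
Proof.
move=> [a b] [a' b'] /eqP; rewrite /iota2 /= -!tofracM -!tofracD tofrac_eq => /eqP e.
congr (_, _).
  by move/(congr1 (fun p : {poly F} => p`_1)): e; rewrite !coefD !coefMX !coefC /= !addr0.
by move/(congr1 (fun p : {poly F} => p`_0)): e; rewrite !coefD !coefMX !coefC /= !add0r.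
Qed.

Let iota20 : iota2 (0, 0) = 0.
Proof. by rewrite /iota2 /= !rmorph0 mul0r addr0. Qed.

Let y2_neq0 i : y2 i != 0. Proof. exact: pole_neq0. Qed.
Let y2_inj : injective y2. Proof. exact: pole_inj. Qed.

(** A difference [a u + b] is a multiple of 1 if [a = 0], and otherwise equals [a * (u + b / a)]. *)
Let y2_diff i (g : K2 -> K2) : \sum_(k | k != i) g (y2 k - y2 i) =
  \sum_(m <- map (const_frac K1) M2) \sum_(l : F | l != 0) g (phi2 l * m).
Proof.
case: i => i1 i2; pose h (t : F * F) : F * F := (t.1 + i1, t.2 + i2).
have hb : bijective h.
  by exists (fun t => (t.1 - i1, t.2 - i2)) => -[a b]; rewrite /h /= ?addrK ?subrK.
rewrite (reindex h); last exact: onW_bij.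
have -> : \sum_(t | h t != (i1, i2)) g (y2 (h t) - y2 (i1, i2)) =
    \sum_(t : F * F | (t.1 != 0) || (t.2 != 0)) g (const_frac K1 (iota2 t)).
  apply: eq_big => [[a b]|[a b] _].
    by rewrite /h xpair_eqE negb_and /= -(subr_eq0 _ i1) -(subr_eq0 _ i2) !addrK.
  rewrite /y2 pole_diff; congr (g (const_frac K1 _)).
  by rewrite /iota2 /h /= !rmorphD /=; ring.
rewrite -(pair_big_dep predT (fun a b => (a != 0) || (b != 0))
  (fun a b => g (const_frac K1 (iota2 (a, b))))).
have e0 l : iota2 (0, l) = phi1 l.
  by rewrite /iota2 [(_, _).1]/= [(_, _).2]/= rmorph0 mul0r add0r.
have e1 l m : iota2 (l, l * m) = phi1 l * y1 m.
  rewrite /iota2 [(_, _).1]/= [(_, _).2]/= rmorphM -mulrDr.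
  by rewrite /y1 /pole /pole_poly tofracD.
have phi2E l : phi2 l = const_frac K1 (phi1 l) by [].
rewrite (bigD1 0) // big_cons; apply: (f_equal2 +%R).
  apply: eq_big => l; first by rewrite eqxx.
  by rewrite e0 phi2E rmorph1 mulr1.
rewrite big_map big_map [RHS]exchange_big; apply: eq_bigr => l /andP[_ l0].
rewrite (reindex_inj (mulfI l0)); apply: eq_big => b; first by rewrite l0.
by rewrite e1 phi2E rmorphM.
Qed.

Let p1 j : K1 := 1 + S1 j.

Let monic_sum2 j : monic_sum (map (const_frac K1) M2) j = const_frac K1 (p1 j).
Proof.
have -> : p1 j = \sum_(m <- M2) m ^- j.
  by rewrite /M2 big_cons expr1n invr1 big_map.
rewrite /monic_sum big_map rmorph_sum; apply: eq_bigr => m _.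
by rewrite fmorphV rmorphXn.
Qed.

Let S2M a b : (0 < a)%N -> (0 < b)%N -> S2 a * S2 b = S2 (a + b) +
  \sum_(1 <= j < a + b)
    phi2 (Delta F a b j) * (S2 (a + b - j) * const_frac K1 (p1 j)).
Proof.
move=> a0 b0; rewrite (power_sumM y2_neq0 y2_inj y2_diff) //.
by congr (_ + _); apply: eq_bigr => j _; rewrite monic_sum2.
Qed.

(** Together with the symmetry [DeltaC], this is all that associativity requires of [Delta]. *)
Lemma Delta_tail_cyclic a b c m : (0 < a)%N -> (0 < b)%N -> (0 < c)%N ->
  (1 <= m < a + b + c)%N ->
  tail_head (Delta F) a b c m = tail_head (Delta F) b c a m /\ (forall s,
    (1 <= s < m)%N ->
    tail_coef (Delta F) a b c m s = tail_coef (Delta F) b c a m s).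
Proof.
apply: (tail_coefs_cyclic S1M S2M).
  by move=> n c0 e; apply: pole_independent (@inj_id F) (erefl : id 0 = 0) n c0 e.
move=> n e e0; apply: (pole_independent iota2_inj iota20 (c0 := 0)).
by rewrite rmorph0 add0r.
Qed.

End DeltaIdentity.

(** * Associativity *)

(* Stated for abstract operations on an abstract module: with the concrete
   ones, failing unification attempts unfold [sh_f] and [{malg F[_]}]. *)
Section Associativity.
Variables (F : finFieldType) (E : lmodType F).
Variables (basis : word F -> E) (pre : letter F -> {linear E -> E}).
Variables (shuf diam : E -> {linear E -> E}) (depth_le : nat -> E -> Prop).

Definition shuf_x j p := shuf (basis (xw F j)) p.

Definition diam_tail x y p : E :=
  pre (lmul x y (weight x + weight y)) p
  + \sum_(1 <= j < weight x + weight y) Delta F (weight x) (weight y) j *: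
      pre (lmul x y (weight x + weight y - j)) (shuf_x j p).

Hypothesis basis_ind : forall P : E -> Prop,
  P 0 -> (forall c p q, P p -> P q -> P (c *: p + q)) ->
  (forall w, P (basis w)) -> forall p, P p.
Hypothesis depth_ind : forall n (P : E -> Prop),
  P 0 -> (forall c p q, P p -> P q -> P (c *: p + q)) ->
  (forall w, (size w <= n)%N -> P (basis w)) ->
  forall p, depth_le n p -> P p.
Hypothesis depth_basis : forall w, depth_le (size w) (basis w).
Hypothesis depth_shuf : forall m n p q,
  depth_le m p -> depth_le n q -> depth_le (m + n) (shuf p q).
Hypothesis pre_basis : forall x w, pre x (basis w) = basis (x :: w).
Hypothesis shufC : forall p q, shuf p q = shuf q p.
Hypothesis diamC : forall p q, diam p q = diam q p.
Hypothesis shuf1p : forall p, shuf (basis [::]) p = p.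
Hypothesis diam1p : forall p, diam (basis [::]) p = p.
Hypothesis shuf_cons : forall x a y b,
  shuf (basis (x :: a)) (basis (y :: b)) =
  pre x (shuf (basis a) (basis (y :: b)))
  + pre y (shuf (basis (x :: a)) (basis b))
  + diam_tail x y (shuf (basis a) (basis b)).
Hypothesis diam_cons : forall x a y b,
  diam (basis (x :: a)) (basis (y :: b)) =
  diam_tail x y (shuf (basis a) (basis b)).

Lemma shufPl c p q r : shuf (c *: p + q) r = c *: shuf p r + shuf q r.
Proof. by rewrite shufC linearP !(shufC r). Qed.

Lemma diamPl c p q r : diam (c *: p + q) r = c *: diam p r + diam q r.
Proof. by rewrite diamC linearP !(diamC r). Qed.

Lemma shuf0p r : shuf 0 r = 0. Proof. by rewrite shufC linear0. Qed.
Lemma diam0p r : diam 0 r = 0. Proof. by rewrite diamC linear0. Qed.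

Lemma shufDl p q r : shuf (p + q) r = shuf p r + shuf q r.
Proof. by rewrite shufC linearD !(shufC r). Qed.

Lemma diam_tail_is_linear x y : linear (diam_tail x y).
Proof.
move=> c p q; rewrite /diam_tail linearP scalerDr scaler_sumr addrACA -big_split.
congr (_ + _); apply: eq_bigr => j _.
by rewrite /= /shuf_x !linearP.
Qed.

HB.instance Definition _ x y := GRing.isLinear.Build F E E *:%R
  (diam_tail x y) (diam_tail_is_linear x y).

Lemma diam_tailC x y p : diam_tail x y p = diam_tail y x p.
Proof.
rewrite /diam_tail (addnC (weight x)) lmulC; congr (_ + _).
by apply: eq_bigr => j _; rewrite DeltaC lmulC.
Qed.

Lemma shuf_pre x p y q : shuf (pre x p) (pre y q) =
  pre x (shuf p (pre y q)) + pre y (shuf (pre x p) q)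
  + diam_tail x y (shuf p q).
Proof.
have P3 (c : F) (u u' v v' w w' : E) : c *: (u + v + w) + (u' + v' + w') =
    c *: u + u' + (c *: v + v') + (c *: w + w').
  by rewrite !scalerDr addrACA (addrACA (c *: u)).
elim/basis_ind: p => [|c p p' IH IH'|u].
- by rewrite linear0 !shuf0p !linear0 !addr0.
- by rewrite linearP !shufPl IH IH' !linearP P3.
elim/basis_ind: q => [|c q q' IH IH'|v].
- by rewrite !linear0 !addr0.
- by rewrite !linearP IH IH' P3.
by rewrite !pre_basis shuf_cons.
Qed.

Lemma diam_pre x p y q :
  diam (pre x p) (pre y q) = diam_tail x y (shuf p q).
Proof.
elim/basis_ind: p => [|c p p' IH IH'|u].
- by rewrite linear0 diam0p shuf0p linear0.
- by rewrite linearP diamPl shufPl IH IH' linearP.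
elim/basis_ind: q => [|c q q' IH IH'|v].
- by rewrite !linear0.
- by rewrite !linearP IH IH'.
by rewrite !pre_basis diam_cons.
Qed.

(** The diamond product of [x U], [y V], [z W], where [t] is the shuffle of [U], [V], [W]; see
    [diam_tail_diam]. *)
Definition triple_tail x y z t : E :=
  diam_tail (lmul x y (weight x + weight y)) z t
  + \sum_(1 <= j < weight x + weight y) Delta F (weight x) (weight y) j *:
      diam_tail (lmul x y (weight x + weight y - j)) z (shuf_x j t).

Definition assoc_upto n := forall i j k p q r, (i + j + k <= n)%N ->
  depth_le i p -> depth_le j q -> depth_le k r ->
  shuf (shuf p q) r = shuf p (shuf q r).

(** [shuf_pre] is applied to each term of [diam_tail]. The strict depth bound leaves room for the
    extra letter [x_j], so the induction hypothesis can move it out of the product. *)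
Lemma diam_tail_shuf n i k x y s z r : assoc_upto n -> (i + k.+1 < n)%N ->
  depth_le i s -> depth_le k r -> depth_le k.+1 (pre z r) ->
  shuf (diam_tail x y s) (pre z r) =
  diam_tail x y (shuf s (pre z r)) + pre z (shuf (diam_tail x y s) r)
  + triple_tail x y z (shuf s r).
Proof.
move=> an ik1n di dk dk1.
have ikn : (i + k < n)%N by apply: leq_ltn_trans ik1n; rewrite leq_add2l.
have assoc_x j m t : depth_le m t -> (i + m < n)%N ->
    shuf (shuf_x j s) t = shuf_x j (shuf s t).
  move=> dm im; apply: (an 1%N i m) => //; exact: (depth_basis (xw F j)).
have suml (I : eqType) (l : seq I) (c : I -> F) (f : I -> E) t :
    shuf (\sum_(i <- l) c i *: f i) t = \sum_(i <- l) c i *: shuf (f i) t.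
  rewrite shufC linear_sum; apply: eq_bigr => ? _.
  by rewrite linearZ shufC.
rewrite /diam_tail /triple_tail !shufDl !suml shuf_pre.
under eq_bigr => j _ do rewrite shuf_pre (assoc_x _ k.+1) // (assoc_x _ k) // 2!scalerDr.
rewrite !big_split /= linearD linear_sum /=.
under [X in _ = _ + (_ + X) + _]eq_bigr => j _ do rewrite linearZ /=.
by rewrite addrACA [X in X + _ = _]addrACA.
Qed.

Let Xs j := basis (xw F j).

Lemma shuf_letters j k : (0 < j)%N -> (0 < k)%N ->
  shuf (Xs k) (Xs j) =
  basis [:: mkletter k 1%g; mkletter j 1%g]
  + basis [:: mkletter j 1%g; mkletter k 1%g]
  + (Xs (k + j) + \sum_(1 <= l < k + j) Delta F k j l *:
      basis [:: mkletter (k + j - l) 1%g; mkletter l 1%g]).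
Proof.
move=> j0 k0; rewrite /Xs /xw shuf_cons.
have shufp1 p : shuf p (basis [::]) = p by rewrite shufC.
rewrite shuf1p shufp1 shuf1p !pre_basis /diam_tail.
rewrite !weight_mkletter // lmul1 pre_basis; congr (_ + (_ + _)).
apply: eq_bigr => l _; congr (_ *: _).
by rewrite lmul1 /shuf_x shufp1 pre_basis.
Qed.

(** Word counterpart of [tail1E], with [x_m] in place of [p1 m] and [x_s x_(m - s)] in place of
    [S1 s]. *)
Definition tail_vec a b c m : E := tail_head (Delta F) a b c m *: Xs m +
  \sum_(1 <= s < m) tail_coef (Delta F) a b c m s *:
     basis [:: mkletter s 1%g; mkletter (m - s) 1%g].

Lemma tail_vecE a b c m :
  triple_lin (Delta F) a b c m *: Xs m + \sum_(1 <= j < m)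
    triple_quad (Delta F) a b c j (m - j) *: shuf (Xs (m - j)) (Xs j) =
  tail_vec a b c m.
Proof.
rewrite /tail_vec -(tail_expand _ _ _ (fun j => triple_quad (Delta F) a b c j (m - j))
  _ (fun s t => basis [:: mkletter s 1%g; mkletter t 1%g])).
congr (_ + _); apply: eq_big_nat => j /andP[j0 jm]; congr (_ *: _).
by rewrite shuf_letters ?subn_gt0 // subnK // ltnW.
Qed.

(** After [triple_expand], the letters [x_k] and [x_j] act on [t] in succession. The induction
    hypothesis, at depth [1 + 1 + d], lets them be shuffled together first, which yields
    [tail_vec]. *)
Lemma triple_tailE n d x y z t : assoc_upto n -> (d + 2 <= n)%N ->
  depth_le d t ->
  triple_tail x y z t =
  let N := (weight x + weight y + weight z)%N in
  let L m := pre (mkletter m (x.2 * y.2 * z.2)%g) in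
  L N t + \sum_(1 <= m < N) L (N - m)%N
     (shuf (tail_vec (weight x) (weight y) (weight z) m) t).
Proof.
move=> an dn dt.
set a := weight x; set b := weight y; set c := weight z.
pose N := (a + b + c)%N; pose L m := pre (mkletter m (x.2 * y.2 * z.2)%g).
change (triple_tail x y z t = L N t + \sum_(1 <= m < N) L (N - m)%N
  (shuf (tail_vec a b c m) t)).
have dtl k s : (0 < k)%N -> diam_tail (lmul x y k) z s = L (k + c)%N s +
    \sum_(1 <= i < k + c) Delta F k c i *: L (k + c - i)%N (shuf_x i s).
  by move=> k0; rewrite /diam_tail /L weight_lmul.
rewrite /triple_tail dtl ?addn_gt0 //.
have -> : \sum_(1 <= j < a + b)
    Delta F a b j *: diam_tail (lmul x y (a + b - j)) z (shuf_x j t) =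
  \sum_(1 <= j < a + b) Delta F a b j *:
    (L (N - j)%N (shuf_x j t) +
     \sum_(1 <= k < a + b - j + c) Delta F (a + b - j) c k *:
       L (N - (j + k))%N (shuf_x k (shuf_x j t))).
  apply: eq_big_nat => j /andP[j0 jab]; congr (_ *: _).
  rewrite dtl ?subn_gt0 // /N addnBAC; last exact: ltnW.
  by congr (_ + _); apply: eq_bigr => k _; rewrite subnDA.
rewrite (triple_expand _ _ _ _ (fun k => L (N - k)%N (shuf_x k t))
  (fun j k => L (N - (j + k))%N (shuf_x k (shuf_x j t)))) //.
congr (_ + _); apply: eq_bigr => m _.
rewrite -tail_vecE shufPl linearP; congr (_ + _).
rewrite shufC linear_sum linear_sum; apply: eq_big_nat => j /andP[_ jm].
rewrite linearZ linearZ subnKC; last exact: ltnW.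
congr (_ *: L _ _); rewrite [RHS]shufC.
by rewrite (an 1%N 1%N d) 1?addnC //; exact: (depth_basis (xw F _)).
Qed.

Lemma triple_tail_cyclic n d x y z t : assoc_upto n -> (d + 2 <= n)%N ->
  depth_le d t -> triple_tail x y z t = triple_tail y z x t.
Proof.
move=> an dn dt; rewrite !(triple_tailE _ _ _ an dn dt) /=.
have -> : (x.2 * y.2 * z.2 = y.2 * z.2 * x.2)%g.
  by apply: val_inj; rewrite /= [RHS]mulrC mulrA.
have -> : (weight y + weight z + weight x = weight x + weight y + weight z)%N.
  by rewrite addnC addnA.
congr (_ + _); apply: eq_big_nat => m mN; congr (pre _ (shuf _ _)).
have [hE cE] := @Delta_tail_cyclic F (weight x) (weight y) (weight z) m isT isT isT mN.
rewrite /tail_vec hE; congr (_ + _); apply: eq_big_nat => s sm.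
by rewrite cE.
Qed.

Lemma assoc_words n :
  (forall u v w, (size u + size v + size w <= n)%N ->
    shuf (shuf (basis u) (basis v)) (basis w) =
    shuf (basis u) (shuf (basis v) (basis w))) -> assoc_upto n.
Proof.
move=> an i j k p q r ijk di dj dk.
move: p di; apply: depth_ind => [|c p p' IH IH'|u ui].
- by rewrite !shuf0p.
- by rewrite !shufPl IH IH'.
move: q dj; apply: depth_ind => [|c q q' IH IH'|v vj].
- by rewrite shuf0p !linear0 shuf0p.
- by rewrite linearP !shufPl linearP IH IH'.
move: r dk; apply: depth_ind => [|c r r' IH IH'|w wk].
- by rewrite !linear0.
- by rewrite !linearP IH IH'.
by apply: an; apply: leq_trans ijk; rewrite !leq_add.
Qed.

(** The terms are grouped so that rotating the three words cyclically permutes the terms inside each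
    group and leaves only [triple_tail_cyclic] to be used on the last one. *)
Lemma shuf3_cons n x u y v z w : assoc_upto n ->
  (size u + size v + size w + 2 <= n)%N ->
  let X := basis (x :: u) in let Y := basis (y :: v) in
  let Z := basis (z :: w) in
  let p := basis u in let q := basis v in let r := basis w in
  shuf (shuf X Y) Z = pre x (shuf (shuf p Y) Z) + pre y (shuf (shuf X q) Z)
    + pre z (shuf (shuf X Y) r)
    + (diam_tail x z (shuf (shuf p Y) r) + diam_tail y z (shuf (shuf X q) r)
       + diam_tail x y (shuf (shuf p q) Z))
    + triple_tail x y z (shuf (shuf p q) r).
Proof.
move=> an uvw X Y Z p q r.
have eX : X = pre x p by rewrite pre_basis.
have eY : Y = pre y q by rewrite pre_basis.
have eZ : Z = pre z r by rewrite pre_basis.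
have eXY : shuf X Y = pre x (shuf p Y) + pre y (shuf X q)
    + diam_tail x y (shuf p q) by rewrite eX eY shuf_pre.
have dq : depth_le (size u + size v) (shuf p q) by apply: depth_shuf.
have dZ : depth_le (size w).+1 (pre z r).
  by rewrite pre_basis; apply: (depth_basis (z :: w)).
have e1 : shuf (pre x (shuf p Y)) Z = pre x (shuf (shuf p Y) Z)
    + pre z (shuf (pre x (shuf p Y)) r) + diam_tail x z (shuf (shuf p Y) r).
  by rewrite eZ shuf_pre.
have e2 : shuf (pre y (shuf X q)) Z = pre y (shuf (shuf X q) Z)
    + pre z (shuf (pre y (shuf X q)) r) + diam_tail y z (shuf (shuf X q) r).
  by rewrite eZ shuf_pre.
have e3 : shuf (diam_tail x y (shuf p q)) Z = diam_tail x y (shuf (shuf p q) Z)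
    + pre z (shuf (diam_tail x y (shuf p q)) r) + triple_tail x y z (shuf (shuf p q) r).
  rewrite eZ; apply: (diam_tail_shuf _ _ an _ dq (depth_basis w) dZ).
  by lia.
(* The three terms led by [z] alone recombine into a single one. *)
have e4 : pre z (shuf (shuf X Y) r) = pre z (shuf (pre x (shuf p Y)) r)
    + pre z (shuf (pre y (shuf X q)) r) + pre z (shuf (diam_tail x y (shuf p q)) r).
  by rewrite eXY !shufDl !linearD.
rewrite e4 eXY 2!shufDl e1 e2 e3.
by rewrite (AC (3*3*3) (1*4*(2*5*8)*(3*6*7)*9)).
Qed.

(** By commutativity, associativity is invariance of [(p q) r] under cyclic rotation. Both sides are
    expanded by [shuf3_cons], and the induction hypothesis rotates every inner product, each of
    total depth at most [n]. *)
Lemma assoc_all n : assoc_upto n.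
Proof.
elim: n => [|n an]; apply: assoc_words => -[|x u] v w; rewrite ?shuf1p //.
case: v => [|y v]; first by rewrite shuf1p (shufC _ (basis [::])) shuf1p.
case: w => [|z w]; first by rewrite shufC shuf1p (shufC _ (basis [::])) shuf1p.
rewrite /= => uvw.
have uvw2 : (size u + size v + size w + 2 <= n)%N by lia.
have rot a b c : (size a + size b + size c <= n)%N ->
    shuf (shuf (basis a) (basis b)) (basis c) =
    shuf (shuf (basis b) (basis c)) (basis a).
  move=> abc; rewrite [RHS]shufC.
  by apply: an abc _ _ _; apply: depth_basis.
rewrite [RHS]shufC (shuf3_cons x y z an uvw2).
rewrite (@shuf3_cons n y v z w x u an); last by lia.
rewrite (rot u (y :: v) (z :: w)) /=; last by lia.
rewrite (rot (x :: u) v (z :: w)) /=; last by lia.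
rewrite (rot (x :: u) (y :: v) w) /=; last by lia.
rewrite (rot u (y :: v) w) /=; last by lia.
rewrite (rot (x :: u) v w) /=; last by lia.
rewrite (rot u v (z :: w)) /=; last by lia.
rewrite (rot u v w) /=; last by lia.
rewrite (@triple_tail_cyclic n (size v + size w + size u)) //; first last.
- by do !apply: depth_shuf.
- by lia.
rewrite (diam_tailC z x) (diam_tailC y x).
congr (_ + _ + _).
  by rewrite [RHS]addrC addrA.
by rewrite addrC addrA.
Qed.

Lemma shufA p q r : shuf (shuf p q) r = shuf p (shuf q r).
Proof.
elim/basis_ind: p => [|c p p' IH IH'|u].
- by rewrite !shuf0p.
- by rewrite !shufPl IH IH'.
elim/basis_ind: q => [|c q q' IH IH'|v].
- by rewrite shuf0p !linear0 shuf0p.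
- by rewrite linearP !shufPl linearP IH IH'.
elim/basis_ind: r => [|c r r' IH IH'|w].
- by rewrite !linear0.
- by rewrite !linearP IH IH'.
by apply: (assoc_all (leqnn _)); apply: depth_basis.
Qed.

Lemma diam_tail_diam x y s z r :
  diam (diam_tail x y s) (pre z r) = triple_tail x y z (shuf s r).
Proof.
rewrite {1}/diam_tail diamC linearD linear_sum /=; congr (_ + _).
  by rewrite diamC diam_pre.
apply: eq_bigr => j _; rewrite linearZ /= diamC diam_pre.
by rewrite /shuf_x shufA.
Qed.

(** No further induction on depth: on nonempty words both sides are a [triple_tail] over the shuffle
    of the tails, so [shufA] and [triple_tail_cyclic] suffice. *)
Lemma diamA p q r : diam (diam p q) r = diam p (diam q r).
Proof.
elim/basis_ind: p => [|c p p' IH IH'|u].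
- by rewrite !diam0p.
- by rewrite !diamPl IH IH'.
elim/basis_ind: q => [|c q q' IH IH'|v].
- by rewrite diam0p !linear0 diam0p.
- by rewrite linearP !diamPl linearP IH IH'.
elim/basis_ind: r => [|c r r' IH IH'|w].
- by rewrite !linear0.
- by rewrite !linearP IH IH'.
case: u => [|x u]; first by rewrite !diam1p.
case: v => [|y v]; first by rewrite diam1p (diamC _ (basis [::])) diam1p.
case: w => [|z w]; first by rewrite diamC diam1p (diamC _ (basis [::])) diam1p.
rewrite [RHS]diamC !diam_cons -(pre_basis z) -(pre_basis x) !diam_tail_diam.
rewrite (@triple_tail_cyclic _ (size u + size v + size w) _ _ _ _
  (@assoc_all _) (leqnn _)); last by do !apply: depth_shuf.
by congr triple_tail; rewrite shufA shufC.
Qed.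

End Associativity.

(** * Associativity of the concrete products *)

Section Products.
Variable F : finFieldType.

Lemma sh_assoc (a b d : D F) : sh (sh a b) d = sh a (sh b d).
Proof.
apply: (@shufA F (D F) (@bw F) (fun x => [the {linear D F -> D F} of lcons x])
  (fun p => [the {linear D F -> D F} of sh p]) (@dle F)) a b d.
- exact: D_ind.
- exact: dle_ind.
- by move=> w; apply: dle_bw.
- exact: dle_sh.
- exact: lcons_bw.
- exact: shC.
- exact: sh1p.
- move=> x a y b; rewrite /= !sh_bw sh_w_cons dia_w_cons; exact: erefl.
Qed.

Lemma dia_assoc (a b d : D F) : dia (dia a b) d = dia a (dia b d).
Proof.
apply: (@diamA F (D F) (@bw F) (fun x => [the {linear D F -> D F} of lcons x])
  (fun p => [the {linear D F -> D F} of sh p])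
  (fun p => [the {linear D F -> D F} of dia p]) (@dle F)) a b d.
- exact: D_ind.
- exact: dle_ind.
- by move=> w; apply: dle_bw.
- exact: dle_sh.
- exact: lcons_bw.
- exact: shC.
- exact: diaC.
- exact: sh1p.
- exact: dia1p.
- move=> x a y b; rewrite /= !sh_bw sh_w_cons dia_w_cons; exact: erefl.
- move=> x a y b; rewrite /= dia_bw sh_bw dia_w_cons; exact: erefl.
Qed.

End Products.

(* (D, dia) and (D, sh) are commutative F_q-algebras with unit the empty word:
   each product is bilinear, associative, commutative, and has unit one_D. *)
Theorem theorem5p9 (F : finFieldType) :
  (forall (c : F) (a b d : D F), dia (c *: a + b) d = c *: dia a d + dia b d) /\
  (forall (c : F) (a b d : D F), dia d (c *: a + b) = c *: dia d a + dia d b) /\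
  (forall a b d : D F, dia (dia a b) d = dia a (dia b d)) /\
  (forall a b : D F, dia a b = dia b a) /\
  (forall a : D F, dia (one_D F) a = a /\ dia a (one_D F) = a) /\
  (forall (c : F) (a b d : D F), sh (c *: a + b) d = c *: sh a d + sh b d) /\
  (forall (c : F) (a b d : D F), sh d (c *: a + b) = c *: sh d a + sh d b) /\
  (forall a b d : D F, sh (sh a b) d = sh a (sh b d)) /\
  (forall a b : D F, sh a b = sh b a) /\
  (forall a : D F, sh (one_D F) a = a /\ sh a (one_D F) = a).
Proof.
have sh1 (a : D F) : sh a (one_D F) = a by rewrite shC sh1p.
have dia1 (a : D F) : dia a (one_D F) = a by rewrite diaC dia1p.
split; first by move=> c a b d; apply: diaPl.
split; first by move=> c a b d; apply: diaPr.
split; first exact: dia_assoc.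
split; first exact: diaC.
split; first by move=> a; split; [apply: dia1p | apply: dia1].
split; first by move=> c a b d; apply: shPl.
split; first by move=> c a b d; apply: shPr.
split; first exact: sh_assoc.
split; first exact: shC.
by move=> a; split; [apply: sh1p | apply: sh1].
Qed.
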